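(* Let $(P,\leq)=(P,\land,\lor)$ be a lattice in which every principal order ideal $\{y\in P: y\le x\}$ is finite, and let $f:P\to\mathbb{C}$ be semimultiplicative with $f(x)\neq 0$ for all $x\in P$. Let $S=\{x_1,\ldots,x_n\}$ be a meet closed subset of $P$ with distinct elements, indexed so that $x_i<x_j\Rightarrow i<j$. If $S$ is a chain, then the join matrix $[S]_f$ is invertible if and only if $f(x_k)\neq f(x_{k-1})$ for $k=2,3,\ldots,n$. If $S$ is an $x_1$-set, then $[S]_f$ is invertible if and only if $f(x_k)\neq f(x_1)$ for $k=2,3,\ldots,n$.
   Context: $f$ is semimultiplicative if $f(x)f(y)=f(x\land y)f(x\lor y)$ for all $x,y\in P$. A subset $S$ is meet closed if $x,y\in S\Rightarrow x\land y\in S$. The join matrix $[S]_f$ is the $n\times n$ matrix with $(i,j)$ entry $f(x_i\lor x_j)$. $S$ is an $x_1$-set if $x_i\land x_j=x_1$ for all $i\neq j$. *)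

(* Defs.v *)
From HB Require Import structures.
From mathcomp Require Import all_boot all_order all_algebra.
From mathcomp Require Import classical_sets cardinality reals.
From mathcomp Require Import complex.

Set Implicit Arguments.
Unset Strict Implicit.
Unset Printing Implicit Defensive.

Import Order.TTheory GRing.Theory Num.Theory.

Local Open Scope classical_set_scope.
Local Open Scope ring_scope.

Definition principal_ideal (d : Order.disp_t) (P : latticeType d) (x : P) :
  set P := [set y | (y <= x)%O].

Definition finite_principal_ideals (d : Order.disp_t) (P : latticeType d) :
  Prop := forall x : P, finite_set (principal_ideal x).

Definition semimultiplicative (d : Order.disp_t) (P : latticeType d)
    (K : comPzRingType) (f : P -> K) : Prop :=
  forall x y : P, f x * f y = f (x `&` y)%O * f (x `|` y)%O.

Definition meet_closed_set (d : Order.disp_t) (P : latticeType d) (S : set P) :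
  Prop := forall x y : P, S x -> S y -> S (x `&` y)%O.

Definition is_chain (d : Order.disp_t) (P : latticeType d) (S : set P) :
  Prop := forall x y : P, S x -> S y -> (x <= y)%O \/ (y <= x)%O.

(* Sets {x_1, ..., x_n} are enumerated from 0: x_1 is [x ord0]. *)
Definition is_x1_set (d : Order.disp_t) (P : latticeType d) (n : nat)
    (x : 'I_n.+1 -> P) : Prop :=
  forall i j : 'I_n.+1, i != j -> (x i `&` x j)%O = x ord0.

Definition join_matrix (d : Order.disp_t) (P : latticeType d)
    (K : comPzRingType) (n : nat) (x : 'I_n -> P) (f : P -> K) : 'M[K]_n :=
  \matrix_(i < n, j < n) f (x i `|` x j)%O.

(* Main.v *)
(** Semimultiplicativity gives [f (a \/ b) = f a * h (a /\ b) * f b] with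
    [h = 1 / f], so the join matrix is [D *m M *m D] with [D] diagonal and
    invertible and [M] the meet matrix of [h].  In a chain and in an [x_1]-set
    alike, the elements of [S] strictly below [x_k], for [x_k] not the least
    element, are those weakly below a single element [x_(p k)] of [S] (take
    [p k = k - 1], resp. [p k = 1]).  With [delta_1 = h (x_1)] and
    [delta_j = h (x_j) - h (x_(p j))] for [j > 1], the sum of the [delta_j] over
    [x_j <= x_k] telescopes to [h (x_k)], so that [M = E *m Delta *m E^T], where
    [E] is the unitriangular incidence matrix of [S] and [Delta] the diagonal
    matrix of the [delta_j]. *)

Require Import Defs.
From HB Require Import structures.
From mathcomp Require Import all_boot all_order all_algebra.
From mathcomp Require Import classical_sets cardinality reals.
From mathcomp Require Import complex.

Set Implicit Arguments.
Unset Strict Implicit.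
Unset Printing Implicit Defensive.

Import Order.TTheory GRing.Theory Num.Theory.

Local Open Scope classical_set_scope.
Local Open Scope ring_scope.

Section ForestLikeMeetClosed.

Variables (d : Order.disp_t) (P : latticeType d) (K : fieldType) (n : nat).
Variable x : 'I_n.+1 -> P.
Hypothesis x_inj : injective x.
Hypothesis x_ord : forall i j : 'I_n.+1, (x i < x j)%O -> (i < j)%N.

Lemma le_index (i j : 'I_n.+1) : (x i <= x j)%O -> (i <= j)%N.
Proof.
by rewrite le_eqVlt => /orP[/eqP/x_inj-> //|/x_ord/ltnW].
Qed.

Lemma le_index0 (i : 'I_n.+1) : (x i <= x ord0)%O = (i == ord0).
Proof.
by apply/idP/eqP => [/le_index|-> //]; rewrite leqn0 => /eqP i0; apply/val_inj.
Qed.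

Definition incidence_matrix : 'M[K]_n.+1 := \matrix_(i, j) (x j <= x i)%O%:R.

(** By [le_index] the indexing extends the order of [S], so the matrix is lower triangular with ones
    on the diagonal. *)
Lemma det_incidence_matrix : \det incidence_matrix = 1.
Proof.
rewrite det_trig ?big1 // => [i _|]; first by rewrite mxE lexx.
apply/is_trig_mxP => i j ij; rewrite mxE; case: (boolP (x j <= x i)%O) => // /le_index.
by rewrite leqNgt ij.
Qed.

Variable p : 'I_n.+1 -> 'I_n.+1.
Hypothesis p_pred : forall j k : 'I_n.+1,
  (0 < k)%N -> (x j < x k)%O = (x j <= x (p k))%O.

(** Möbius inversion of [h] over the poset [S], reduced to two terms by [p_pred]. Nothing constrains
    [p ord0], hence the separate case. *)
Definition pred_diff (h : P -> K) (k : 'I_n.+1) : K :=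
  if k == ord0 then h (x ord0) else h (x k) - h (x (p k)).

Lemma sum_pred_diff (h : P -> K) (k : 'I_n.+1) :
  \sum_(j | (x j <= x k)%O) pred_diff h j = h (x k).
Proof.
have [m] := ubnP (nat_of_ord k); elim: m k => // m IH k km.
have [->|k0] := eqVneq k ord0.
  by rewrite (eq_bigl _ _ le_index0) big_pred1_eq /pred_diff eqxx.
have k_gt0 : (0 < k)%N by rewrite lt0n; apply: contraNneq k0 => k0; apply/eqP/val_inj.
rewrite (bigD1 k) //= {1}/pred_diff (negPf k0).
have -> : \sum_(j | (x j <= x k)%O && (j != k)) pred_diff h j =
          \sum_(j | (x j <= x (p k))%O) pred_diff h j.
  apply: eq_bigl => j; rewrite -p_pred // lt_neqAle andbC.
  by rewrite (inj_eq x_inj).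
(* [p_pred] at [j := p k] reads [x (p k) <= x (p k)] on the right, so [x (p k) < x k]. *)
have pk : (p k < k)%N by apply: x_ord; rewrite p_pred.
by rewrite IH ?subrK // (leq_trans pk).
Qed.

Hypothesis S_meet : meet_closed_set (range x).

(** The [(i, j)] entry of the product sums [pred_diff h k] over the [x k] below both [x i] and
    [x j], that is, below their meet; this meet is some [x l], so [sum_pred_diff] evaluates the
    sum. *)
Lemma meet_matrix_factor (h : P -> K) :
  \matrix_(i, j) h (x i `&` x j)%O =
  incidence_matrix *m diag_mx (\row_k pred_diff h k) *m incidence_matrix^T.
Proof.
apply/matrixP => i j; rewrite mul_mx_diag !mxE.
have [l _ xl] : range x (x i `&` x j)%O by apply: S_meet; [exists i|exists j].
rewrite -xl -sum_pred_diff big_mkcond; apply: eq_bigr => k _; rewrite !mxE xl lexI.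
by do 2!case: (_ <= _)%O; rewrite ?mul1r ?mulr1 ?mulr0 ?mul0r.
Qed.

Variable f : P -> K.
Hypothesis f_smul : semimultiplicative f.
Hypothesis f_neq0 : forall y : P, f y != 0.

Lemma join_matrix_factor :
  join_matrix x f =
  diag_mx (\row_k f (x k)) *m (\matrix_(i, j) (f (x i `&` x j)%O)^-1) *m
  diag_mx (\row_k f (x k)).
Proof.
apply/matrixP => i j; rewrite mul_mx_diag mul_diag_mx !mxE.
by rewrite mulrAC f_smul mulrAC divff // mul1r.
Qed.

Lemma det_join_matrix :
  \det (join_matrix x f) =
  (\prod_k f (x k)) ^+ 2 * \prod_k pred_diff (fun y => (f y)^-1) k.
Proof.
rewrite join_matrix_factor (meet_matrix_factor (fun y => (f y)^-1)).
rewrite !det_mulmx det_tr det_incidence_matrix !det_diag mulr1 mul1r.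
under eq_bigr do rewrite mxE.
by under [X in _ * X * _]eq_bigr do rewrite mxE; rewrite mulrAC -expr2.
Qed.

Lemma join_matrix_unit :
  join_matrix x f \in unitmx <->
  forall k : 'I_n.+1, (0 < k)%N -> f (x k) != f (x (p k)).
Proof.
rewrite unitmxE unitfE det_join_matrix mulf_eq0 expf_eq0 /= negb_or.
have -> : \prod_k f (x k) != 0 by apply/prodf_neq0.
split=> [/prodf_neq0 H k k0|H].
  have := H k isT; rewrite /pred_diff -val_eqE /= eqn0Ngt k0 /=.
  by rewrite subr_eq0 (inj_eq invr_inj).
(* The factor at [ord0] is an inverse value of [f], so it never vanishes and imposes no
   condition. *)
apply/prodf_neq0 => k _; rewrite /pred_diff; case: (eqVneq k ord0) => [_|k0].
  by rewrite invr_eq0 f_neq0.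
by rewrite subr_eq0 (inj_eq invr_inj) H // lt0n.
Qed.

End ForestLikeMeetClosed.

Lemma chain_lt_index (d : Order.disp_t) (P : latticeType d) (n : nat)
    (x : 'I_n.+1 -> P) :
  injective x -> (forall i j : 'I_n.+1, (x i < x j)%O -> (i < j)%N) ->
  is_chain (range x) -> forall i j : 'I_n.+1, (x i < x j)%O = (i < j)%N.
Proof.
move=> x_inj x_ord ch i j; apply/idP/idP => [/x_ord //|ij].
have [xij|xji] : (x i <= x j)%O \/ (x j <= x i)%O by apply: ch; [exists i|exists j].
  by rewrite lt_neqAle xij (inj_eq x_inj) andbT; apply: contraTneq ij => ->; rewrite ltnn.
by have := le_index x_inj x_ord xji; rewrite leqNgt ij.
Qed.

Theorem theorem5p1 (R : realType) (d : Order.disp_t) (P : latticeType d)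
    (P_fin : finite_principal_ideals P)
    (f : P -> R[i]) (f_smul : semimultiplicative f)
    (f_neq0 : forall y : P, f y != 0)
    (n : nat) (x : 'I_n.+1 -> P) (x_inj : injective x)
    (x_ord : forall i j : 'I_n.+1, (x i < x j)%O -> (i < j)%N)
    (S_meet : meet_closed_set (range x)) :
  (is_chain (range x) ->
     (join_matrix x f \in unitmx <->
      forall i k : 'I_n.+1, k = i.+1 :> nat -> f (x k) != f (x i)))
  /\
  (is_x1_set x ->
     (join_matrix x f \in unitmx <->
      forall k : 'I_n.+1, (0 < k)%N -> f (x k) != f (x ord0))).
Proof.
split=> [ch|x1].
  have lt_x := chain_lt_index x_inj x_ord ch.
  (* The order of a chain is that of its indices, so [p k] is [k.-1], which is in range: [inord]
     does not return its default. *)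
  have pP (j k : 'I_n.+1) : (0 < k)%N -> (x j < x k)%O = (x j <= x (inord k.-1))%O.
    move=> k0; have kn : (k.-1 < n.+1)%N by rewrite (leq_ltn_trans (leq_pred k)).
    rewrite le_eqVlt !lt_x (inj_eq x_inj) -val_eqE /= inordK //.
    by rewrite -leq_eqVlt -[RHS]ltnS prednK.
  rewrite (join_matrix_unit x_inj x_ord pP S_meet f_smul f_neq0).
  split=> [H i k ki|H k k0].
    have -> : i = inord k.-1 by rewrite ki /= inord_val.
    by apply: H; rewrite ki.
  apply: H; rewrite inordK ?prednK //.
  by rewrite ltnW.
apply: (join_matrix_unit x_inj x_ord (p := fun=> ord0)) => // j k k0.
rewrite (le_index0 x_inj x_ord).
have k_neq0 : k != ord0 by rewrite -val_eqE -lt0n.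
(* If [x j < x k], then [x j] is the meet of two distinct elements, hence [x ord0]. *)
apply/idP/eqP => [ltjk|->].
  apply: (x_inj); rewrite -(x1 j k); last by rewrite -(inj_eq x_inj) lt_eqF.
  by rewrite (meet_idPl (ltW ltjk)).
rewrite lt_neqAle (inj_eq x_inj) eq_sym k_neq0 /=.
by rewrite leEmeet (x1 ord0 k) // eq_sym.
Qed.
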